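(* Let $d\ge1$, and let $x_i\in\mathbb{R}^d$ and $y_i\in\{0,1\}$ for $i=1,\dots,n$, with $n_1=\sum_{i=1}^n y_i>0$ and $n_0=n-n_1>0$. Put $\widetilde x_i=(1,x_i^{\mathsf T})^{\mathsf T}\in\mathbb{R}^{d+1}$. Assume: (1) (Full rank) the $n\times(d+1)$ matrix with $i$-th row $\widetilde x_i^{\mathsf T}$ has full rank $d+1\le n$. (2) (Overlap) $S\cap F\neq\varnothing$, where $$S=\Bigl\{\sum_{i:y_i=1}k_i\widetilde x_i \;\Big|\; k_i>0\Bigr\},\qquad F=\Bigl\{\sum_{i:y_i=0}k_i\widetilde x_i \;\Big|\; k_i>0\Bigr\}.$$ (3) (Link) $G:\mathbb{R}\to[0,1]$ is a non-decreasing function for which the link function $G^{-1}$ exists on $(0,1)$ (for every $p\in(0,1)$ there is exactly one $z\in\mathbb{R}$ with $G(z)=p$), $G$ is strictly increasing at every $z$ with $0<G(z)<1$, and both $-\log(G(z))$ and $-\log(1-G(z))$ are convex functions of $z\in\mathbb{R}$ (with values in $[0,+\infty]$). Let $\bar x_1=\frac1{n_1}\sum_{i=1}^n y_ix_i$ and $\bar x_0=\frac1{n_0}\sum_{i=1}^n(1-y_i)x_i$. If $\bar x_1-\bar x_0\neq0$ and $(\hat\alpha,\hat\beta)\in\mathbb{R}\times\mathbb{R}^d$ maximizes the log likelihood $$\ell(\alpha,\beta)=\sum_{i=1}^n y_i\log\bigl(G(\alpha+x_i^{\mathsf T}\beta)\bigr)+(1-y_i)\log\bigl(1-G(\alpha+x_i^{\mathsf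 T}\beta)\bigr)$$ over $\alpha\in\mathbb{R}$, $\beta\in\mathbb{R}^d$, then $\hat\beta^{\mathsf T}(\bar x_1-\bar x_0)>0$.
   Context: Binary regression model: $\Pr(Y=1\mid X=x)=G(\alpha+x^{\mathsf T}\beta)$, where $G$ is the inverse link function (usually a cumulative distribution function) and $G^{-1}$ is called the link function. Convex functions are allowed to take the value $+\infty$; conventions are $\log 0=-\infty$ and $0\cdot(-\infty)=0$. ''$G$ is strictly increasing at $z$'' means $G(z')<G(z)<G(z'')$ whenever $z'<z<z''$. *)

(* Defs.v *)
From mathcomp Require Import all_boot all_order all_algebra.
From mathcomp Require Import all_classical all_reals all_analysis.

Set Implicit Arguments.
Unset Strict Implicit.
Unset Printing Implicit Defensive.

Import Order.TTheory GRing.Theory Num.Theory.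

Local Open Scope classical_set_scope.
Local Open Scope ring_scope.

Section BinaryRegression.
Variable R : realType.

(* The library's [convex_function] only covers real-valued functions. Used here
   for functions that never take the value -oo, so the sum is never an
   indeterminate form; [0 * +oo = 0] makes the cases [t = 0, 1] trivial. *)
Definition econvex (f : R -> \bar R) : Prop :=
  forall (a b t : R), 0 <= t <= 1 ->
    (f (t * a + (1 - t) * b)%R <= t%:E * f a + (1 - t)%:E * f b)%E.

Definition strictly_increasing_at (G : R -> R) (z : R) : Prop :=
  forall z' z'' : R, z' < z -> z < z'' -> G z' < G z /\ G z < G z''.

Section Data.
Variables (n d : nat) (x : 'I_n -> 'cV[R]_d) (y : 'I_n -> bool).

Definition xtilde (i : 'I_n) : 'cV[R]_(1 + d) := col_mx (const_mx 1) (x i).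

Definition design : 'M[R]_(n, 1 + d) := \matrix_(i < n) (xtilde i)^T.

Definition pos_cone (P : pred 'I_n) : set 'cV[R]_(1 + d) :=
  [set v | exists k : 'I_n -> R,
    (forall i, P i -> 0 < k i) /\ v = \sum_(i < n | P i) k i *: xtilde i].

Definition n1 : nat := (\sum_(i < n) y i)%N.

Definition n0 : nat := (n - n1)%N.

Definition xbar1 : 'cV[R]_d := n1%:R^-1 *: \sum_(i < n) (y i)%:R *: x i.

Definition xbar0 : 'cV[R]_d := n0%:R^-1 *: \sum_(i < n) (1 - (y i)%:R) *: x i.

Definition dot (u v : 'cV[R]_d) : R := (u^T *m v) 0 0.

(* [lne 0 = -oo] and [0 * -oo = 0] in [\bar R]; every logarithm below is
   nonpositive when [G] takes its values in [0, 1]. *)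
Definition loglik (G : R -> R) (alpha : R) (beta : 'cV[R]_d) : \bar R :=
  (\sum_(i < n)
     ((y i)%:R%:E * lne (G (alpha + dot (x i) beta)%R)%:E
      + (1 - (y i)%:R)%:E * lne (1 - G (alpha + dot (x i) beta))%:E))%E.

End Data.
End BinaryRegression.

(* Main.v *)
Require Import Defs.
From mathcomp Require Import all_boot all_order all_algebra.
From mathcomp Require Import all_classical all_reals all_analysis.
From mathcomp Require Import ring lra.

Set Implicit Arguments.
Unset Strict Implicit.
Unset Printing Implicit Defensive.

Import Order.TTheory GRing.Theory Num.Theory.
Import numFieldNormedType.Exports.

Local Open Scope classical_set_scope.
Local Open Scope ring_scope.

(* Let [p] be the proportion of ones and [G z = p], so that [(z, 0)] is the best
   constant model. Convexity gives supporting lines of [- log G] and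
   [- log (1 - G)] at [z]; the exponentials of these lines bound [G] from above
   and from below and touch at [z], so the slopes are [- s / p] and
   [s / (1 - p)] for a common [s > 0]. Summing the supporting lines over the data
   bounds [loglik] at [(alpha, beta)] by its value at [(z, 0)] plus
   [n s beta^T (xbar1 - xbar0)]. In the other direction, the bounds on [G] give a
   smooth minorant of [t |-> loglik (z, t (xbar1 - xbar0))], exact at [t = 0] and
   with positive derivative there, so a maximizer does strictly better than
   [(z, 0)]. *)

(** * Supporting lines of extended-valued convex functions *)

(** The slope is the supremum of the left difference quotients at [z], each of which is at most
    every right one. The points [u0] and [v0] provide a left quotient and an upper bound, so the
    supremum is finite. *)
Lemma econvex_subgradient (R : realType) (f : R -> \bar R) (u0 z v0 : R) :
  econvex f -> (forall w, f w != -oo%E) -> u0 < z < v0 ->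
  f u0 \is a fin_num -> f z \is a fin_num -> f v0 \is a fin_num ->
  exists a : R, forall w, (f z + (a * (w - z))%:E <= f w)%E.
Proof.
move=> fcvx fNy /andP[u0z zv0] fu0 fz fv0.
pose F w := fine (f w).
have slope u v : u < z -> z < v -> f u \is a fin_num -> f v \is a fin_num ->
    (F z - F u) / (z - u) <= (F v - F z) / (v - z).
  move=> uz zv fu fv.
  have uv : 0 < v - u by rewrite subr_gt0 (lt_trans uz).
  pose t := (v - z) / (v - u).
  have t01 : 0 <= t <= 1.
    apply/andP; split; first by apply: divr_ge0; lra.
    by rewrite ler_pdivrMr// mul1r; lra.
  have tz : t * u + (1 - t) * v = z by rewrite /t; field; lra.
  have := fcvx u v t t01.
  rewrite tz -(fineK fu) -(fineK fv) -(fineK fz) -!EFinM -EFinD lee_fin.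
  rewrite -/(F z) -/(F u) -/(F v) => H.
  have {}H : F z * (v - u) <= (v - z) * F u + (z - u) * F v.
    move: H; rewrite -(ler_pM2r uv); congr (_ <= _).
    by rewrite /t; field; lra.
  rewrite ler_pdivrMr ?subr_gt0// mulrAC ler_pdivlMr ?subr_gt0//; nra.
(* [fine] sends [+oo] to 0, so quotients through points of infinite value are left out; at such
   points the claimed inequality is trivial. *)
pose S := [set (F z - F u) / (z - u) | u in [set u | u < z /\ f u \is a fin_num]].
have S0 : S !=set0 by exists ((F z - F u0) / (z - u0)), u0.
have Sv v : z < v -> f v \is a fin_num -> ubound S ((F v - F z) / (v - z)).
  by move=> zv fv _ [u [uz fu] <-]; exact: slope.
exists (sup S) => w.
have [fw|] := boolP (f w \is a fin_num); last first.
  by move: (fNy w); case: (f w) => // _ _; rewrite leey.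
rewrite -(fineK fw) -(fineK fz) -EFinD lee_fin -/(F z) -/(F w).
have [wz|zw|->] := ltgtP w z; last by rewrite subrr mulr0 addr0.
- have : (F z - F w) / (z - w) <= sup S.
    by apply: ub_le_sup; [exists ((F v0 - F z) / (v0 - z)); exact: Sv|exists w].
  by rewrite ler_pdivrMr ?subr_gt0//; lra.
- have : sup S <= (F w - F z) / (w - z) by apply: ge_sup => //; exact: Sv.
  by rewrite ler_pdivlMr ?subr_gt0//; lra.
Qed.

(** * Calculus for the smooth minorant *)

Lemma is_derive_expRM (R : realType) (k t : R) :
  is_derive t 1 (fun t => expR (k * t)) (k * expR (k * t)).
Proof.
have h : is_derive t 1 (fun t : R => k * t) k.
  by apply: is_derive_eq; rewrite /GRing.scale/=; ring.
rewrite [k * expR _]mulrC.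
exact: (@is_derive1_comp _ expR (fun t : R => k * t)).
Qed.

Lemma is_derive_onem_expR (R : realType) (q k : R) :
  is_derive (0 : R) 1 (fun t : R => 1 - q * expR (k * t)) (- (q * k)).
Proof.
have dk := is_derive_expRM k 0.
by apply: is_derive_eq; rewrite /GRing.scale/= mulr0 expR0; ring.
Qed.

Lemma is_derive_ln_onem_expR (R : realType) (q k : R) : q < 1 ->
  is_derive (0 : R) 1 (fun t => ln (1 - q * expR (k * t))) (- (q * k / (1 - q))).
Proof.
move=> q1.
have gt0 : 0 < 1 - q * expR (k * 0) by rewrite mulr0 expR0 mulr1 subr_gt0.
have := @is_derive1_comp _ (@ln R) _ 0 _ _ (is_derive1_ln gt0)
  (is_derive_onem_expR q k).
by rewrite mulr0 expR0 mulr1 mulrC mulNr.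
Qed.

Lemma near_onem_expR_gt0 (R : realType) (q k : R) : q < 1 ->
  \forall t \near (0 : R)^'+, 0 < 1 - q * expR (k * t).
Proof.
move=> q1.
have : {for (0 : R), continuous (fun t : R => 1 - q * expR (k * t))}.
  apply/differentiable_continuous/derivable1_diffP.
  exact: (@ex_derive _ _ _ _ _ _ _ (is_derive_onem_expR q k)).
move=> /cvg_at_right_filter /cvgr_gt; apply.
by rewrite mulr0 expR0 mulr1 subr_gt0.
Qed.

(** The sum [h] of the two exponential terms is at least 1 and equals 1 at 0. So 0 is a minimum, and
    the derivative [p * A - (1 - p) * B] vanishes there. *)
Lemma expR_tangent_eq (R : realType) (p A B : R) :
  (forall t : R, 1 - (1 - p) * expR (- B * t) <= p * expR (A * t)) ->
  p * A = (1 - p) * B.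
Proof.
move=> H.
pose h t := p * expR (A * t) + (1 - p) * expR (- B * t).
have dh (t : R) : is_derive t 1 h
    (p * (A * expR (A * t)) + (1 - p) * (- B * expR (- B * t))).
  have dA := is_derive_expRM A t; have dB := is_derive_expRM (- B) t.
  by apply: is_derive_eq; rewrite /GRing.scale/=; ring.
have : is_derive (0 : R) 1 h 0.
  apply: (@derive1_at_min _ _ (-1) 1) => [|t _||t _].
  - lra.
  - exact: ex_derive.
  - by rewrite in_itv/=; lra.
  - rewrite /h !mulr0 expR0; have := H t; lra.
move=> /@derive_val; rewrite (@derive_val _ _ _ _ _ _ _ (dh 0)) !mulr0 expR0; lra.
Qed.

Lemma is_derive_pos_right (R : realType) (h : R -> R) (D : R) :
  is_derive (0 : R) 1 h D -> 0 < D -> \forall t \near 0^'+, h 0 < h t.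
Proof.
move=> [dh hD] D0; move: dh; rewrite /derivable => /cvg_ex[l hl].
have lD : l = D by rewrite -hD; apply/esym/cvg_lim.
have : (fun t : R => t^-1 * (h (t * 1 + 0) - h 0)) @ (0 : R)^' --> D.
  by rewrite -lD; exact: hl.
move=> /cvgr_gt /(_ _ D0).
rewrite /dnbhs /at_right !near_withinE; apply: filterS => t /= H t0.
have := H (lt0r_neq0 t0).
by rewrite addr0 mulr1 pmulr_rgt0 ?invr_gt0// subr_gt0.
Qed.

(** * Exponential bounds on [G] *)

Lemma lne_le_expR (R : realType) (g p c : R) : 0 <= g -> 0 < p ->
  (lne g%:E <= (ln p + c)%:E)%E -> g <= p * expR c.
Proof.
move=> g0 p0; have [->|gN0] := eqVneq g 0; first by rewrite mulr_ge0 ?expR_ge0// ltW.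
have {g0 gN0}g0 : 0 < g by rewrite lt_def gN0.
rewrite lne_EFin// lee_fin => H.
by rewrite -[g]lnK// -{1}[p]lnK// -expRD ler_expR.
Qed.

(* Both subgradient inequalities sandwich [G] between smooth functions touching
   at [z], so their slopes agree although [G] is not assumed differentiable. *)
Lemma link_tangent (R : realType) (G : R -> R) (u z v : R) :
  (forall w, 0 <= G w <= 1) ->
  econvex (fun w => (- lne (G w)%:E)%E) ->
  econvex (fun w => (- lne (1 - G w)%:E)%E) ->
  u < z < v -> 0 < G u -> G u < G z -> G z < G v -> G v < 1 ->
  exists2 s : R, 0 < s & forall w,
    (lne (G w)%:E <= (ln (G z) + s / G z * (w - z))%:E)%E /\
    (lne (1 - G w)%:E <= (ln (1 - G z) - s / (1 - G z) * (w - z))%:E)%E.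
Proof.
move=> G01 cvx1 cvx0 uzv Gu Guz Gzv Gv.
set p := G z.
have lne_fin (r : R) : 0 < r -> (- lne r%:E)%E \is a fin_num.
  by move=> r0; rewrite lne_EFin.
have lneNy (r : R) : r <= 1 -> (- lne r%:E)%E != -oo%E.
  move=> r1; rewrite -ltNye (lt_le_trans (ltNyr 0))//.
  by rewrite oppe_ge0 lne_le0 lee_fin.
have [a Ha] : exists a : R, forall w, (lne (G w)%:E <= (ln p + a * (w - z))%:E)%E.
  have [||||a Ha] := econvex_subgradient cvx1 _ uzv.
  - by move=> w; apply: lneNy; have /andP[] := G01 w.
  - exact: lne_fin.
  - by apply: lne_fin; lra.
  - by apply: lne_fin; lra.
  exists (- a) => w; rewrite -leeN2; apply: le_trans (Ha w).
  by rewrite -/p lne_EFin ?/p//=; [rewrite lee_fin; lra|lra].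
have [b Hb] : exists b : R,
    forall w, (lne (1 - G w)%:E <= (ln (1 - p) - b * (w - z))%:E)%E.
  have [||||b Hb] := econvex_subgradient cvx0 _ uzv.
  - by move=> w; apply: lneNy; have /andP[] := G01 w; lra.
  - by apply: lne_fin; lra.
  - by apply: lne_fin; lra.
  - by apply: lne_fin; lra.
  exists b => w; rewrite -leeN2; apply: le_trans (Hb w).
  by rewrite -/p lne_EFin ?/p//=; [rewrite lee_fin; lra|lra].
have p0 : 0 < p by rewrite /p; lra.
have p1 : 0 < 1 - p by rewrite /p; lra.
have Ga w : G w <= p * expR (a * (w - z)).
  by apply: lne_le_expR => //; have /andP[] := G01 w.
have Gb w : 1 - G w <= (1 - p) * expR (- b * (w - z)).
  by apply: lne_le_expR => //; [have /andP[] := G01 w; lra|rewrite mulNr].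
have ab : p * a = (1 - p) * b.
  apply: expR_tangent_eq => t.
  have := Ga (z + t); have := Gb (z + t); rewrite addrAC subrr add0r; lra.
exists (p * a).
  apply: mulr_gt0 => //.
  (* The upper bound at [v] exceeds [G v > p], which forces [a > 0]. *)
  have : p < p * expR (a * (v - z)) by apply: lt_le_trans (Ga v).
  rewrite -[X in X < _]mulr1 ltr_pM2l// expR_gt1.
  by case/andP: uzv => _ zv; rewrite pmulr_lgt0 ?subr_gt0.
move=> w; rewrite {2}ab.
have -> : p * a / p = a by field; rewrite gt_eqF.
by have -> : (1 - p) * b / (1 - p) = b by field; rewrite gt_eqF.
Qed.

(** * Inner products and the weighted sum over the data *)

Lemma dotDl (R : realType) (d : nat) (u v w : 'cV[R]_d) :
  dot (u + v) w = dot u w + dot v w.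
Proof. by rewrite /dot linearD mulmxDl mxE. Qed.

Lemma dotZl (R : realType) (d : nat) (a : R) (u w : 'cV[R]_d) :
  dot (a *: u) w = a * dot u w.
Proof. by rewrite /dot linearZ/= -scalemxAl mxE. Qed.

Lemma dotC (R : realType) (d : nat) (u v : 'cV[R]_d) : dot u v = dot v u.
Proof.
by rewrite /dot !mxE; apply: eq_bigr => i _; rewrite !mxE mulrC.
Qed.

Lemma dot_suml (R : realType) (d n : nat) (F : 'I_n -> 'cV[R]_d) (w : 'cV[R]_d) :
  dot (\sum_i F i) w = \sum_i dot (F i) w.
Proof. by rewrite /dot linear_sum mulmx_suml summxE. Qed.

Lemma dot_gt0 (R : realType) (d : nat) (u : 'cV[R]_d) : u != 0 -> 0 < dot u u.
Proof.
move=> u0; have [i ui] : exists i, u i 0 != 0.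
  apply/existsP; apply: contra_neqT u0 => /existsPn u0.
  by apply/colP => i; rewrite mxE; apply/eqP/negPn/u0.
rewrite /dot mxE (bigD1 i)//= !mxE ltr_wpDr//.
  by apply: sumr_ge0 => j _; rewrite mxE -expr2 sqr_ge0.
by rewrite -expr2 exprn_even_gt0.
Qed.

Section Score.
Context (R : realType) (n d : nat) (x : 'I_n -> 'cV[R]_d) (y : 'I_n -> bool).

Let n1R : \sum_i (y i)%:R = (n1 y)%:R :> R.
Proof. by rewrite /n1 natr_sum. Qed.

Lemma n1Dn0 : (n1 y + n0 y)%N = n.
Proof.
rewrite /n0 subnKC// /n1.
by rewrite -[leqRHS]card_ord -sum1_card leq_sum// => i _; exact: leq_b1.
Qed.

Let n0R : \sum_i (1 - (y i)%:R) = (n0 y)%:R :> R.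
Proof. by rewrite sumrB n1R sumr_const card_ord -{1}n1Dn0 natrD addrC addKr. Qed.

(** The weights sum to 1 over the ones and to -1 over the zeros, so the intercept [a] cancels and a
    difference of group means is left. *)
Lemma score_eq (hn1 : (0 < n1 y)%N) (hn0 : (0 < n0 y)%N) (a : R) (b : 'cV[R]_d) :
  \sum_i ((y i)%:R / (n1 y)%:R - (1 - (y i)%:R) / (n0 y)%:R) * (a + dot (x i) b)
  = dot b (xbar1 x y - xbar0 x y).
Proof.
have n1N0 : (n1 y)%:R != 0 :> R by rewrite pnatr_eq0 -lt0n.
have n0N0 : (n0 y)%:R != 0 :> R by rewrite pnatr_eq0 -lt0n.
rewrite dotC -scaleN1r dotDl dotZl /xbar1 /xbar0 !dotZl !dot_suml mulN1r.
under eq_bigr => i _.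
  rewrite (_ : _ * _ = ((n1 y)%:R^-1 * dot ((y i)%:R *: x i) b
      - (n0 y)%:R^-1 * dot ((1 - (y i)%:R) *: x i) b)
      + a * ((y i)%:R / (n1 y)%:R - (1 - (y i)%:R) / (n0 y)%:R)); last first.
    by rewrite !dotZl; ring.
  over.
rewrite big_split/= sumrB -!mulr_sumr sumrB -!mulr_suml n1R n0R.
by rewrite !divff// subrr mulr0 addr0.
Qed.

End Score.

(** * Bounding the log likelihood from both sides *)

Lemma loglikE (R : realType) (n d : nat) (x : 'I_n -> 'cV[R]_d)
    (y : 'I_n -> bool) (G : R -> R) (a : R) (b : 'cV[R]_d) :
  loglik x y G a b = (\sum_i (if y i then lne (G (a + dot (x i) b))%:E
                              else lne (1 - G (a + dot (x i) b))%:E))%E.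
Proof.
apply: eq_bigr => i _; case: (y i); first by rewrite mul1e subrr mul0e adde0.
by rewrite mul0e subr0 mul1e add0e.
Qed.

Theorem theorem3 (R : realType) (n d : nat) (hd : (1 <= d)%N)
    (x : 'I_n -> 'cV[R]_d) (y : 'I_n -> bool)
    (hn1 : (0 < n1 y)%N) (hn0 : (0 < n0 y)%N)
    (hdn : (d + 1 <= n)%N)
    (hrank : \rank (design x) = (d + 1)%N)
    (hoverlap : pos_cone x (fun i => y i) `&` pos_cone x (fun i => ~~ y i)
                !=set0)
    (G : R -> R)
    (hG01 : forall z : R, 0 <= G z <= 1)
    (hGmono : {homo G : z w / z <= w})
    (hGlink : forall p : R, 0 < p < 1 -> exists! z, G z = p)
    (hGstrict : forall z : R, 0 < G z < 1 -> strictly_increasing_at G z)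
    (hGconv1 : econvex (fun z => (- lne (G z)%:E)%E))
    (hGconv0 : econvex (fun z => (- lne (1 - G z)%:E)%E))
    (hxbar : xbar1 x y - xbar0 x y != 0)
    (alphahat : R) (betahat : 'cV[R]_d)
    (hmax : forall (alpha : R) (beta : 'cV[R]_d),
        (loglik x y G alpha beta <= loglik x y G alphahat betahat)%E) :
  0 < dot betahat (xbar1 x y - xbar0 x y).
Proof.
pose N1 : R := (n1 y)%:R; pose N0 : R := (n0 y)%:R.
have N1_gt0 : 0 < N1 by rewrite ltr0n.
have N0_gt0 : 0 < N0 by rewrite ltr0n.
have N_gt0 : 0 < N1 + N0 by rewrite addr_gt0.
pose p := N1 / (N1 + N0).
have p0 : 0 < p by rewrite divr_gt0.
have p1 : p < 1 by rewrite ltr_pdivrMr// mul1r; lra.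
have monoG a b : G a < G b -> a < b.
  by apply: contraTT; rewrite -!leNgt; exact: hGmono.
have [z [Gz _]] : exists! z, G z = p by apply: hGlink; rewrite p0.
(* Any values in [(0, p)] and [(p, 1)] would do: they give points on both sides of [z] where both
   logarithms are finite. *)
have [u [Gu _]] : exists! u, G u = p / 2 by apply: hGlink; lra.
have [v [Gv _]] : exists! v, G v = (1 + p) / 2 by apply: hGlink; lra.
have uz : u < z by apply: monoG; lra.
have zv : z < v by apply: monoG; lra.
have [|||||s s0] :=
    link_tangent hG01 hGconv1 hGconv0 (u := u) (z := z) (v := v).
- by rewrite uz.
- by lra.
- by lra.
- by lra.
- by lra.
rewrite Gz => tangent.
(* With this choice of [p], the tangent slopes become [k] times the weights of [score_eq]. *)
pose k := s * (N1 + N0).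
have k0 : 0 < k by rewrite mulr_gt0.
have sp : s / p = k / N1 by rewrite /k /p; field; rewrite !gt_eqF.
have sq : s / (1 - p) = k / N0.
  by rewrite /k /p; field; rewrite !gt_eqF//; lra.
set delta := xbar1 x y - xbar0 x y.
pose w i : R := (y i)%:R / N1 - (1 - (y i)%:R) / N0.
have wt i : w i = if y i then N1^-1 else - N0^-1.
  rewrite /w; case: (y i); last by rewrite mul0r subr0 mul1r sub0r.
  by rewrite subrr mul0r subr0 mul1r.
pose l0 i : R := if y i then ln p else ln (1 - p).
have upper : (loglik x y G alphahat betahat
    <= (\sum_i l0 i + k * dot betahat delta)%:E)%E.
  rewrite loglikE -(score_eq x hn1 hn0 (alphahat - z)) mulr_sumr -big_split/=.
  rewrite -sumEFin; apply: lee_sum => i _.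
  have [Hu Hl] := tangent (alphahat + dot (x i) betahat).
  rewrite -/N1 -/N0 -/(w i) wt /l0; case: (y i).
    by apply: le_trans Hu _; rewrite lee_fin sp; lra.
  by apply: le_trans Hl _; rewrite lee_fin sq; lra.
pose c i := dot (x i) delta.
(* The minorant of each likelihood factor is 1 minus the exponential upper bound on the opposite
   probability; hence a one gets [1 - p] and [N0], a zero gets [p] and [N1]. *)
pose q i : R := if y i then 1 - p else p.
pose r i : R := if y i then - (k / N0 * c i) else k / N1 * c i.
have q1 i : q i < 1 by rewrite /q; case: (y i); lra.
pose h (t : R) := \sum_i ln (1 - q i * expR (r i * t)).
have h0 : h 0 = \sum_i l0 i.
  apply: eq_bigr => i _; rewrite mulr0 expR0 mulr1 /q /l0.
  by case: (y i) => //; congr ln; ring.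
have dh : is_derive (0 : R) 1 h (k * dot delta delta).
  have dhi i := is_derive_ln_onem_expR (r i) (q1 i).
  have := is_derive_sum dhi.
  rewrite -(score_eq x hn1 hn0 0) mulr_sumr.
  have -> : \sum_i (fun t => ln (1 - q i * expR (r i * t))) = h.
    by apply/funext => t; rewrite fct_sumE.
  move=> ?; apply: is_derive_eq; apply: eq_bigr => i _.
  (* The swap is undone by [(1 - p) / N0 = p / N1]: each term has derivative [k * w i * c i] at
     0. *)
  rewrite -/N1 -/N0 -/(w i) wt add0r -/(c i) /q /r /p; case: (y i).
    by field; rewrite !gt_eqF//; lra.
  by field; rewrite !gt_eqF//; lra.
(* Positivity matters because [ln] is 0 by default at nonpositive arguments. *)
have lower t : (forall i, 0 < 1 - q i * expR (r i * t)) ->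
    ((h t)%:E <= loglik x y G z (t *: delta))%E.
  move=> hpos; rewrite loglikE /h -sumEFin; apply: lee_sum => i _.
  have [Hu Hl] := tangent (z + dot (x i) (t *: delta)).
  move: (hpos i) Hu Hl; rewrite dotC dotZl dotC -/(c i) /q /r.
  rewrite [z + _]addrC addrK sp sq; have /andP[G0] := hG01 (t * c i + z).
  rewrite -subr_ge0 => G1.
  case: (y i) => ti Hu Hl; rewrite -lne_EFin// lee_lne ?in_itv/= ?leey ?andbT
    ?lee_fin ?(ltW ti)//.
    have : 1 - G (t * c i + z) <= (1 - p) * expR (- (k / N0 * (t * c i))).
      by apply: lne_le_expR Hl; lra.
    have -> : - (k / N0 * (t * c i)) = - (k / N0 * c i) * t by ring.
    lra.
  have : G (t * c i + z) <= p * expR (k / N1 * (t * c i)) by exact: lne_le_expR Hu.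
  have -> : k / N1 * (t * c i) = k / N1 * c i * t by ring.
  lra.
have dd : 0 < k * dot delta delta by rewrite mulr_gt0// dot_gt0.
have near_pos : \forall t \near (0 : R)^'+,
    h 0 < h t /\ forall i, 0 < 1 - q i * expR (r i * t).
  apply: filterI; first exact: (is_derive_pos_right dh).
  apply: (@filter_forall _ _ _ (at_right (0 : R)) _) => i.
  exact: near_onem_expR_gt0.
have [tau [htau hpos]] :=
  @filter_ex _ _ (at_right_proper_filter (0 : R)) _ near_pos.
(* This puts [h tau], which exceeds [h 0], below [h 0 + k * dot betahat delta]. The likelihoods in
   between are compared in the extended reals, so their finiteness need not be checked. *)
have := le_trans (lower tau hpos) (le_trans (hmax z (tau *: delta)) upper).
rewrite lee_fin -h0 => H.
have : 0 < k * dot betahat delta by lra.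
by rewrite pmulr_rgt0.
Qed.
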